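(* If $T$ is a tree of order $n$, then $$\xi^d(T)-\xi^c(T)\le\begin{cases}\frac{25n^4}{96}-\frac{n^3}{6}-\frac{89n^2}{48}+\frac{19n}{6}-\frac{45}{32}, & n \text{ odd},\\[3pt] \frac{25n^4}{96}-\frac{n^3}{6}-\frac{43n^2}{24}+\frac{19n}{6}-2, & n\text{ even}.\end{cases}$$ Moreover, equality holds if and only if $T=P_n$.
   Context: For a vertex $v$ of a tree $T$: $\deg(v)$ is its degree, $\varepsilon(v)=\max_{u} d(v,u)$ its eccentricity, $D(v)=\sum_u d(v,u)$ its total distance ($d$ the path distance). $\xi^c(T)=\sum_v \varepsilon(v)\deg(v)$ and $\xi^d(T)=\sum_v\varepsilon(v)D(v)$. $P_n$ is the path on $n$ vertices. *)

(* Defs.v *)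
From mathcomp Require Import all_boot all_order all_algebra.

Set Implicit Arguments.
Unset Strict Implicit.
Unset Printing Implicit Defensive.

(* A finite simple graph is a finType V of vertices with a symmetric and
   irreflexive adjacency relation e. *)

Definition simple_graph (V : finType) (e : rel V) : Prop :=
  symmetric e /\ irreflexive e.

(* Connected graphs are required to be nonempty. *)
Definition connected (V : finType) (e : rel V) : Prop :=
  0 < #|V| /\ forall x y : V, connect e x y.

(* ucycle also accepts the empty sequence and, in a simple graph, the edges
   [:: x; y]; genuine cycles have at least three vertices. *)
Definition acyclic (V : finType) (e : rel V) : Prop :=
  forall c : seq V, 2 < size c -> ~ ucycle e c.

Definition is_tree (V : finType) (e : rel V) : Prop :=
  [/\ simple_graph e, connected e & acyclic e].

Definition has_path (V : finType) (e : rel V) (x y : V) (k : nat) : bool :=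
  [exists p : k.-tuple V, [&& path e x p, last x p == y & uniq (x :: p)]].

(* The least length of a path from x to y. A path has fewer than #|V| edges,
   so the bound on k loses nothing; #|V| is a junk value, taken only when
   there is no path. *)
Definition dist (V : finType) (e : rel V) (x y : V) : nat :=
  \big[minn/#|V|]_(k < #|V| | has_path e x y k) k.

Definition deg (V : finType) (e : rel V) (v : V) : nat := #|[set u | e v u]|.

Definition ecc (V : finType) (e : rel V) (v : V) : nat :=
  \max_(u : V) dist e v u.

Definition total_dist (V : finType) (e : rel V) (v : V) : nat :=
  \sum_(u : V) dist e v u.

Definition xi_c (V : finType) (e : rel V) : nat :=
  \sum_(v : V) ecc e v * deg e v.

Definition xi_d (V : finType) (e : rel V) : nat :=
  \sum_(v : V) ecc e v * total_dist e v.

Definition path_graph (n : nat) : rel 'I_n :=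
  fun i j => (i.+1 == j :> nat) || (j.+1 == i :> nat).
Arguments path_graph n i j : clear implicits.

Definition graph_iso (V W : finType) (e : rel V) (e' : rel W) : Prop :=
  exists2 f : V -> W, bijective f & forall x y, e' (f x) (f y) = e x y.

Local Open Scope ring_scope.

Definition extremal_bound (n : nat) : rat :=
  let x : rat := n%:R in
  if odd n then
    25 * x ^+ 4 / 96 - x ^+ 3 / 6 - 89 * x ^+ 2 / 48 + 19 * x / 6 - 45 / 32
  else
    25 * x ^+ 4 / 96 - x ^+ 3 / 6 - 43 * x ^+ 2 / 24 + 19 * x / 6 - 2.

(* Main.v *)
(* With g(1) = 0 and g(k) = k otherwise, xi_d - xi_c is F(V), where F(S) is the
   sum of ecc(v) g(d(v,u)) over u, v in S. Let a, b be at maximal distance L and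
   let I be the set of vertices between them: it spans a path whose
   eccentricities are those of the path itself, so F(I) is the bound B(L+1).
   Grow I to V through convex sets, one vertex w at a time, removing from S the
   vertex outside I farthest from a. If k = |S|, the distances from w to S leave
   no gaps, so they add up to at most k(k-1)/2, and F grows by at most
   L k(k-1) <= (k-2)k(k-1) < B(k) - B(k-1). So F(V) < B(n) unless I = V. All facts
   about trees used here follow from the four-point condition. *)

Require Import Defs.
From mathcomp Require Import all_boot all_order all_algebra.
From mathcomp Require Import zify ring lra.

Set Implicit Arguments.
Unset Strict Implicit.
Unset Printing Implicit Defensive.

(** * Distance as the length of a shortest path *)

Lemma geq_bigmin_cond (I : finType) (P : pred I) (F : I -> nat) (m : nat) (i : I) :
  P i -> \big[minn/m]_(j | P j) F j <= F i.
Proof.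
move=> Pi; have := mem_index_enum i.
elim: (index_enum I) => //= j r IH; rewrite inE big_cons => /predU1P[<-|/IH le].
  by rewrite Pi geq_minl.
by case: ifP => // _; rewrite geq_min le orbT.
Qed.

Lemma dist_le_path (V : finType) (e : rel V) (x : V) (p : seq V) :
  path e x p -> dist e x (last x p) <= size p.
Proof.
move=> pp; have [q pq Uq sqp] := shortenP pp.
have szq : size q < #|V| by have /card_uniqP /= <- := Uq; apply: max_card.
have szqp : size q <= size p by have /andP[_ /uniq_leq_size ->] := Uq.
apply: leq_trans szqp.
apply: (@geq_bigmin_cond _ _ (fun k : 'I_#|V| => k : nat) _ (Ordinal szq)).
by apply/existsP; exists (in_tuple q); apply/and3P.
Qed.

(** A repetition-free path has fewer than [#|V|] edges, so the minimum falls below its default value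
    and comes from an actual path. *)
Lemma connect_dist_path (V : finType) (e : rel V) (x y : V) :
  connect e x y ->
  exists p, [/\ path e x p, last x p = y & size p = dist e x y].
Proof.
case/connectP=> p0 /shortenP[p pp Up _] -> {p0}.
have szp : size p < #|V| by have /card_uniqP /= <- := Up; apply: max_card.
rewrite /dist; set D := \big[_/_]_(_ < _ | _) _.
have Dle : D <= size p.
  apply: (@geq_bigmin_cond _ _ (fun k : 'I_#|V| => k : nat) _ (Ordinal szp)).
  by apply/existsP; exists (in_tuple p); apply/and3P.
suff : D = #|V| \/ has_path e x (last x p) D.
  case=> [DV | /existsP[q /and3P[pq /eqP lq _]]]; first by lia.
  by exists q; rewrite size_tuple.
rewrite /D; apply: (big_ind (fun k => k = #|V| \/ has_path e x (last x p) k)).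
- by left.
- by move=> a b Ha Hb; case: leqP.
- by move=> i; right.
Qed.

(** * Tree distances, up to the four-point condition *)

Section TreeMetric.
Variables (V : finType) (e : rel V).
Hypothesis tree_e : is_tree e.
Local Notation d := (dist e).

Let e_sym : symmetric e. Proof. by case: tree_e => -[]. Qed.
Let e_irr : irreflexive e. Proof. by case: tree_e => -[]. Qed.
Let e_conn x y : connect e x y. Proof. by case: tree_e => _ []. Qed.

Lemma dist_eq0 x y : (d x y == 0) = (x == y).
Proof.
apply/eqP/eqP => [d0|->].
  have [[|z p] [_ /= lp]] := connect_dist_path (e_conn x y); rewrite d0 //.
by apply/eqP; rewrite -leqn0; apply: (@dist_le_path _ _ y [::]).
Qed.

Lemma distxx x : d x x = 0.
Proof. by apply/eqP; rewrite dist_eq0. Qed.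

Lemma dist_sym x y : d x y = d y x.
Proof.
wlog suff: x y / d x y <= d y x by move=> le; apply/eqP; rewrite eqn_leq !le.
have [p [pp lp <-]] := connect_dist_path (e_conn y x).
have := @dist_le_path _ e x (rev (belast y p)).
rewrite -{1}lp rev_path size_rev size_belast.
have -> : last x (rev (belast y p)) = y.
  by case: (p) lp => [|z q] //= _; rewrite rev_cons last_rcons.
by apply; rewrite (eq_path (e' := e)) // => a b; rewrite e_sym.
Qed.

Lemma dist_triangle y x z : d x z <= d x y + d y z.
Proof.
have [p [pp lp <-]] := connect_dist_path (e_conn x y).
have [q [pq lq <-]] := connect_dist_path (e_conn y z).
by rewrite -size_cat -lq -{1}lp -last_cat dist_le_path // cat_path pp lp.
Qed.

Lemma dist_eq1 x y : (d x y == 1) = e x y.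
Proof.
apply/eqP/idP => [d1|exy].
  have [[|z [|? ?]] [/= + lp]] := connect_dist_path (e_conn x y); rewrite d1 // -lp.
  by rewrite andbT.
apply/eqP; rewrite eqn_leq (@dist_le_path _ _ x [:: y]) ?lt0n ?dist_eq0 /= ?exy //.
by apply: contraTneq exy => ->; rewrite e_irr.
Qed.

Lemma dist_step x y k : d x y = k.+1 -> exists2 z, d x z = 1 & d z y = k.
Proof.
move=> dxy; have [[|z p] [/= + lp]] := connect_dist_path (e_conn x y); rewrite dxy //.
case/andP=> exz pp [sp]; move: exz; rewrite -dist_eq1 => /eqP dxz.
exists z => //; apply/eqP; rewrite eqn_leq.
have:= dist_le_path pp; rewrite lp sp => -> /=.
by have := dist_triangle z x y; rewrite dxy dxz.
Qed.

(* Otherwise geodesics from a and b to z avoid u, and close a cycle through u. *)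
Lemma far_neighbor z u a b :
  e u a -> e u b -> a != b -> d a z <= d u z -> d u z < d b z.
Proof.
move=> ua ub ab az; rewrite ltnNge; apply/negP => bz.
pose e' := [rel x y | [&& e x y, x != u & y != u]].
have toz k v : v != u -> d v z <= d u z -> d v z = k -> connect e' v z.
  elim: k v => [|k IH] v vu vz dvz.
    by have/eqP := dvz; rewrite dist_eq0 => /eqP ->.
  have [w vw wz] := dist_step dvz.
  have wu : w != u by apply: contraTneq vz => wu; rewrite -wu wz dvz ltnn.
  apply: connect_trans (IH w wu _ wz); last by rewrite wz; lia.
  by apply: connect1; rewrite /= -dist_eq1 vw vu wu.
have e'_sym : symmetric e' by move=> x y; rewrite /= e_sym andbA andbAC -andbA.
have neu v : e u v -> v != u by apply: contraTneq => ->; rewrite e_irr.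
have /connectP[p0 /shortenP[p pp Up _] lp] : connect e' a b.
  apply: connect_trans (toz _ _ (neu _ ua) az erefl) _.
  by rewrite (sym_connect_sym e'_sym); apply: (toz _ _ (neu _ ub) bz erefl).
case: tree_e => _ _ /(_ [:: u, a & p]); apply.
  by case: (p) lp => //= ba; rewrite ba eqxx in ab.
rewrite /ucycle cons_uniq Up andbT /= rcons_path -lp ua e_sym ub andbT inE eq_sym.
rewrite (negPf (neu _ ua)) /=.
apply/andP; split; first by apply: sub_path pp => x y /and3P[].
apply/negP => up; case/splitPr: up pp => p1 p2.
by rewrite cat_path /= eqxx !andbF.
Qed.

(* By far_neighbor, a geodesic that starts by moving away from z never turns back. *)
Lemma dist_away x' x y z :
  d x x' = 1 -> d x y = (d x' y).+1 -> d x' z = (d x z).+1 ->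
  d y z = d x y + d x z.
Proof.
move: {2}(d x' y) (erefl (d x' y)) => k.
elim: k x x' => [|k IH] x x' dx'y xx' xy x'z.
  have/eqP := dx'y; rewrite dist_eq0 => /eqP x'y; rewrite -x'y x'z.
  by rewrite xx' add1n.
have [x'' x'x'' dx''y] := dist_step dx'y.
have x''z : d x'' z = (d x' z).+1.
  apply/eqP; rewrite eqn_leq; apply/andP; split.
    by have := dist_triangle x' x'' z; rewrite (dist_sym x'' x') x'x''.
  apply: (@far_neighbor z x' x x'').
  - by rewrite e_sym -dist_eq1 xx'.
  - by rewrite -dist_eq1 x'x''.
  - by apply/eqP => xx''; move: xy; rewrite xx''; lia.
  - by rewrite x'z.
by rewrite (IH x' x'' dx''y) ?dx'y ?dx''y //; lia.
Qed.

(** If [x] and [x'] were equidistant from [z], then [x'] and the next vertex from [x] towards [z]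
    would be two neighbours of [x] no farther from [z] than [x], against [far_neighbor]. *)
Lemma dist_neighbor x x' z :
  d x x' = 1 -> d x' z = (d x z).+1 \/ d x z = (d x' z).+1.
Proof.
move=> xx'; have x'x : d x' x = 1 by rewrite dist_sym.
have := dist_triangle x x' z; have := dist_triangle x' x z.
have : d x z != d x' z; last by lia.
apply/eqP=> E.
have : d x z != 0.
  apply/eqP => x0; have/eqP := x0; have/eqP := etrans (esym E) x0.
  by rewrite !dist_eq0 => /eqP x'z /eqP xz; move: xx'; rewrite x'z xz distxx.
case Ez : (d x z) => [|k] // _.
have [w xw wz] := dist_step Ez.
have := @far_neighbor z x w x'; rewrite -!dist_eq1 xw xx' -E ltnn => H.
suff : false by []; apply: H => //; last by lia.
by apply/eqP => ww; move: wz; rewrite ww -E; lia.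
Qed.

(** Induction along a geodesic from [x] to [y]. If its first step moves away from [z] or from [w],
    [dist_away] puts [x] between [y] and that vertex, and the triangle inequality concludes.
    Otherwise all three distances from [x] drop by one, and so do both sides. *)
Lemma four_point x y z w :
  d x y + d z w <= maxn (d x z + d y w) (d x w + d y z).
Proof.
move: {2}(d x y) (erefl (d x y)) => k; elim: k x => [|k IH] x dxy.
  have/eqP := dxy; rewrite dist_eq0 => /eqP <-; rewrite distxx.
  by have := dist_triangle x z w; rewrite (dist_sym z x); lia.
have [x' xx' x'y] := dist_step dxy.
have xy : d x y = (d x' y).+1 by rewrite dxy x'y.
have := IH x' x'y.
case: (dist_neighbor z xx') => [zf _|zc].
  have := dist_away xx' xy zf; have := dist_triangle x z w; rewrite (dist_sym z x); lia.
case: (dist_neighbor w xx') => [wf _|wc]; last by lia.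
have := dist_away xx' xy wf; have := dist_triangle x z w; rewrite (dist_sym z x); lia.
Qed.

End TreeMetric.

(** * The weighted distance sum of a path *)

Definition far (k : nat) : nat := if k == 1 then 0 else k.

(** The share, in the row of a path vertex, of a side that holds [i] vertices. *)
Definition far_below (i : nat) : nat := \sum_(k < i.+1) far k.

(** Here [N] counts edges, so the vertices are 0, ..., [N]. The factor [maxn i (N - i)] is the
    eccentricity of [i], and the two truncated subtractions add up to |i - j|. *)
Definition path_far (N : nat) : nat :=
  \sum_(i < N.+1) \sum_(j < N.+1) maxn i (N - i) * far ((i - j) + (j - i)).

(** A triangular number that loses its term 1 as soon as [i] is positive; doubling avoids
    division. *)
Lemma far_below_closed (i : nat) : far_below i * 2 + (0 < i) * 2 = i * i.+1.
Proof.
rewrite /far_below; elim: i => [|[|i] IH]; first by rewrite big_ord1.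
  by rewrite big_ord_recr big_ord1.
by rewrite big_ord_recr mulnDl addnAC IH /far /=; lia.
Qed.

Lemma sum_far_row (N i : nat) :
  i <= N -> \sum_(j < N.+1) far ((i - j) + (j - i)) = far_below i + far_below (N - i).
Proof.
move=> /subnKC <-; move: (N - i) => r {N}; rewrite addKn.
elim: r => [|r IH].
  rewrite addn0 [far_below 0]big_ord1 addn0 (reindex_inj rev_ord_inj) /=.
  by apply: eq_bigr => j _; congr far; have := ltn_ord j; lia.
rewrite addnS big_ord_recr IH /= [far_below r.+1]big_ord_recr addnA.
by congr (_ + far _) => /=; lia.
Qed.

Lemma path_farE (N : nat) :
  path_far N = \sum_(i < N.+1) maxn i (N - i) * (far_below i + far_below (N - i)).
Proof.
by apply: eq_bigr => i _; rewrite -big_distrr sum_far_row // -ltnS.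
Qed.

Lemma sum_palindrome (m r : nat) (c : nat -> nat) :
  (forall i, i < m -> c (m + r + (m - i.+1)) = c i) ->
  \sum_(i < m + r + m) c i = (\sum_(i < m) c i) * 2 + \sum_(i < r) c (m + i).
Proof.
move=> csym; rewrite big_split_ord big_split_ord /=.
rewrite [X in _ + X](reindex_inj rev_ord_inj) /=.
by rewrite [X in _ + X](eq_bigr (fun i : 'I_m => c i)) => [|i _]; [lia|exact: csym].
Qed.

(** Reflecting the path pairs [i] with [N - i], and on the first half the maximum is [N - i]. The
    number [r] of middle vertices will be 0 or 1, by parity. *)
Lemma path_far_split (m r N : nat) : N.+1 = (m + r + m)%N ->
  path_far N = (\sum_(i < m) (N - i) * (far_below i + far_below (N - i))) * 2 +
    \sum_(i < r) maxn (m + i) (N - (m + i)) *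
      (far_below (m + i) + far_below (N - (m + i))).
Proof.
move=> NE; rewrite path_farE NE.
rewrite (sum_palindrome
  (c := fun i => maxn i (N - i) * (far_below i + far_below (N - i)))).
  congr (_ * _ + _); apply: eq_bigr => i _; congr (_ * _).
  by have := ltn_ord i; lia.
move=> i im; have -> : (m + r + (m - i.+1) = N - i)%N by lia.
by rewrite subKn; [rewrite maxnC addnC | lia].
Qed.

(** Remove an element of largest value: the rest stays gapless, and the removed value is at most the
    number of remaining elements. The induction therefore also carries a bound on each single
    value. *)
Lemma sum_gapless (V : finType) (f : V -> nat) (S : {set V}) :
  (forall u k, u \in S -> f u = k.+1 -> exists2 v, v \in S & f v = k) ->
  (\sum_(u in S) f u) * 2 <= #|S| * (#|S| - 1).
Proof.
suff: forall n (S : {set V}), #|S| = n ->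
    (forall u k, u \in S -> f u = k.+1 -> exists2 v, v \in S & f v = k) ->
    (forall u, u \in S -> f u < n) /\ (\sum_(u in S) f u) * 2 <= n * (n - 1).
  by move=> H gap; have [] := H _ S erefl gap.
elim=> [|n IH] {}S.
  move/cards0_eq => -> _; split; last by rewrite big_set0.
  by move=> u; rewrite inE.
move=> cS gap; have /card_gt0P[u0 u0S] : 0 < #|S| by rewrite cS.
case: (@arg_maxnP _ u0 [in S] f u0S) => w /= wS wmax.
have cS' : #|S :\ w| = n by have := cardsD1 w S; rewrite wS cS; case.
have [|lt_n sum_n] := IH _ cS'.
  move=> u k; rewrite !inE => /andP[uw uS] fu.
  have [v vS fv] := gap u k uS fu; exists v => //; rewrite !inE vS andbT.
  by apply: contraTneq (wmax _ uS) => <-; rewrite fu fv ltnn.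
have fw : f w < n.+1.
  case fw : (f w) => [|k] //; have [v vS fv] := gap w k wS fw.
  rewrite -fv ltnS lt_n // !inE vS andbT; apply/eqP => vw; move: fw; rewrite -vw fv; lia.
split=> [u /wmax /= uw|]; first exact: leq_ltn_trans uw fw.
rewrite (big_setD1 w wS) /=; nia.
Qed.

(** * Intervals, convex sets and the removal of a vertex *)

Section Interval.
Variables (V : finType) (e : rel V).
Hypothesis tree_e : is_tree e.
Local Notation d := (dist e).

Definition interval (x y : V) : {set V} := [set z | d x z + d z y == d x y].

Definition convex (S : {set V}) : Prop :=
  forall x y, x \in S -> y \in S -> interval x y \subset S.

Lemma intervalP x y z : reflect (d x z + d z y = d x y) (z \in interval x y).
Proof. by rewrite inE; apply: eqP. Qed.

(** The distance from [a] is an isometric coordinate: [four_point] on [x], [y], [a], [b] gives the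
    upper bound, the triangle inequality the lower one. *)
Lemma interval_dist a b x y : x \in interval a b -> y \in interval a b ->
  d x y = (d a x - d a y) + (d a y - d a x).
Proof.
move=> /intervalP xI /intervalP yI.
have := four_point tree_e x y a b; have := dist_triangle tree_e x a y.
have := dist_triangle tree_e y a x.
rewrite (dist_sym tree_e x a) (dist_sym tree_e y a) (dist_sym tree_e y x); lia.
Qed.

Lemma interval_convex a b : convex (interval a b).
Proof.
move=> x y xI yI; apply/subsetP => z /intervalP zI; apply/intervalP.
have := interval_dist xI yI.
move/intervalP: xI => xI; move/intervalP: yI => yI.
have := dist_triangle tree_e x a z; have := dist_triangle tree_e y a z.
have := dist_triangle tree_e x z b; have := dist_triangle tree_e y z b.
have := dist_triangle tree_e z a b.
rewrite (dist_sym tree_e z x) (dist_sym tree_e y z); lia.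
Qed.

Lemma interval_point a b i : i <= d a b -> exists2 z, z \in interval a b & d a z = i.
Proof.
elim: i => [|i IH] iab.
  by exists a; rewrite ?inE (distxx tree_e).
have [z /intervalP zI azi] := IH (ltnW iab).
have zb : d z b = (d a b - i.+1).+1 by lia.
have [w zw wb] := dist_step tree_e zb.
have := dist_triangle tree_e z a w; have := dist_triangle tree_e w a b.
by exists w; [apply/intervalP|]; lia.
Qed.

Lemma interval_enum a b : exists g : 'I_(d a b).+1 -> V,
  [/\ injective g, interval a b = [set g i | i in 'I_(d a b).+1]
    & forall i, d a (g i) = i].
Proof.
have ex (i : 'I_(d a b).+1) : exists z, (z \in interval a b) && (d a z == i).
  by have [z zI az] := @interval_point a b i (ltn_ord i); exists z; rewrite zI az /=.
pose g i := xchoose (ex i).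
have gP i : g i \in interval a b /\ d a (g i) = i.
  by have /andP[-> /eqP] := xchooseP (ex i).
exists g; split=> [i j gij||i]; last by case: (gP i).
  by apply/val_inj; rewrite /= -(gP i).2 -(gP j).2 gij.
apply/setP => z; apply/idP/imsetP => [zI|[i _ ->]]; last by case: (gP i).
have azb : d a z < (d a b).+1 by move/intervalP: zI; lia.
exists (Ordinal azb) => //; apply/eqP; rewrite -(dist_eq0 tree_e).
by rewrite (interval_dist zI (gP _).1) (gP _).2 /= subnn.
Qed.

Lemma card_interval a b : #|interval a b| = (d a b).+1.
Proof. by have [g [ginj -> _]] := interval_enum a b; rewrite card_imset // card_ord. Qed.

(** Eccentricities are those of the whole tree, so shrinking [S] only deletes terms. *)
Definition far_sum (S : {set V}) : nat :=
  \sum_(v in S) \sum_(u in S) ecc e v * far (d v u).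

Lemma dist_ecc x y : d x y <= ecc e x.
Proof. by rewrite /ecc (bigD1 y) //= leq_maxl. Qed.

(** In [four_point] on [x], [u], [a], [b], the distances from [u] to [a] and [b] are at most
    [d a b]; hence no [u] is farther from [x] than both ends are. *)
Lemma ecc_diametral a b x : (forall u v, d u v <= d a b) -> x \in interval a b ->
  ecc e x = maxn (d a x) (d a b - d a x).
Proof.
move=> diam /intervalP xI; apply/eqP; rewrite eqn_leq; apply/andP; split.
  apply/bigmax_leqP => u _; have := four_point tree_e x u a b.
  have := diam a u; have := diam u b.
  by rewrite (dist_sym tree_e x a) (dist_sym tree_e u a); lia.
have := dist_ecc x a; have := dist_ecc x b; rewrite (dist_sym tree_e x a); lia.
Qed.

Lemma far_sum_diametral a b : (forall u v, d u v <= d a b) ->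
  far_sum (interval a b) = path_far (d a b).
Proof.
move=> diam; have [g [ginj gI ag]] := interval_enum a b.
have gP i : g i \in interval a b by rewrite gI imset_f.
rewrite /far_sum {1}gI big_imset /=; last by move=> i j _ _; apply: ginj.
rewrite big_mkcond /=; apply: eq_bigr => i _.
rewrite gI big_imset /=; last by move=> i' j _ _; apply: ginj.
apply: eq_big => // j _.
by rewrite (ecc_diametral diam (gP i)) (interval_dist (gP i) (gP j)) !ag.
Qed.

Lemma farther_across_between c w x y : w \in interval x y -> w != x -> w != y ->
  (d c x = d c w + d w x /\ d c w < d c x) \/ (d c y = d c w + d w y /\ d c w < d c y).
Proof.
move=> /intervalP wI wx wy.
have := four_point tree_e c w x y.
have := dist_triangle tree_e w c x; have := dist_triangle tree_e w c y.
move: wx wy; rewrite -!(dist_eq0 tree_e) (dist_sym tree_e x w) in wI *; lia.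
Qed.

(** Were [w] between two remaining vertices, one of them would lie behind [w] as seen from [a].
    Outside the interval this contradicts the choice of [w]; inside, convexity would pull [w] into
    the interval. *)
Lemma convexD1 a b (S : {set V}) w : interval a b \subset S -> convex S ->
  w \in S :\: interval a b ->
  (forall v, v \in S :\: interval a b -> d a v <= d a w) -> convex (S :\ w).
Proof.
move=> IS cS wSI wmax x y; rewrite !inE => /andP[xw xS] /andP[yw yS].
have far_side u : u \in S -> d a u = d a w + d w u -> d a w < d a u -> False.
  move=> uS auw; rewrite ltnNge => /negP; apply.
  have [uI|uI] := boolP (u \in interval a b); last by apply: wmax; rewrite inE uI.
  have aI : a \in interval a b by rewrite inE (distxx tree_e).
  have wI : w \in interval a u by rewrite inE auw.
  by move: wSI; rewrite inE (subsetP (interval_convex aI uI) w wI).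
apply/subsetP => z zI; rewrite !inE (subsetP (cS _ _ xS yS)) // andbT.
apply/eqP => zw; rewrite {z}zw in zI; rewrite eq_sym in xw; rewrite eq_sym in yw.
by have [[]|[]] := @farther_across_between a w x y zI xw yw; apply: far_side.
Qed.

(** The row and the column of [w] each cost at most [L] times the sum of the distances from [w]. By
    convexity geodesics to [w] stay in [S], so [sum_gapless] applies. *)
Lemma far_sumD1 (S : {set V}) w L : (forall u v, d u v <= L) -> convex S -> w \in S ->
  far_sum S <= far_sum (S :\ w) + L * (#|S| * (#|S| - 1)).
Proof.
move=> diam cS wS.
have eccL v : ecc e v <= L by apply/bigmax_leqP => u _.
have farle k : far k <= k by rewrite /far; case: eqP.
have : (\sum_(u in S) d w u) * 2 <= #|S| * (#|S| - 1).
  apply: sum_gapless => u k uS; rewrite (dist_sym tree_e) => wu.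
  have [z uz zw] := dist_step tree_e wu; exists z; last by rewrite dist_sym.
  by apply: (subsetP (cS _ _ uS wS)); apply/intervalP; rewrite uz zw wu.
set D := \sum_(u in S) d w u => HD.
have row : \sum_(u in S) ecc e w * far (d w u) <= L * D.
  by rewrite big_distrr; apply: leq_sum => u _; apply: leq_mul.
have col : \sum_(v in S :\ w) ecc e v * far (d v w) <= L * D.
  rewrite /D (big_setD1 w wS) /= (distxx tree_e) add0n big_distrr.
  by apply: leq_sum => u _; rewrite (dist_sym tree_e); apply: leq_mul.
rewrite /far_sum (big_setD1 w wS) /=.
rewrite [X in _ + X <= _](eq_bigr (fun v => ecc e v * far (d v w) +
                  \sum_(u in S :\ w) ecc e v * far (d v u))).
  have := leq_mul (leqnn L) HD; rewrite big_split mulnA /= => HLD.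
  move: (L * (_ * _)) HLD row col => K; lia.
by move=> v _; rewrite (big_setD1 w wS).
Qed.

End Interval.

Import Order.TTheory GRing.Theory Num.Theory.
Local Open Scope ring_scope.

(** * Closed forms and the growth of the bound *)

Lemma half_path_sum (m N : nat) : (m < N)%N ->
  let t : rat := m%:R in let y : rat := N%:R in
  (\sum_(i < m.+1) (N - i) * (far_below i + far_below (N - i)))%:R =
  - (t * (t + 1) / 2) ^+ 2 + y * t * (t + 1) * (2 * t + 1) / 3
  - (3 * y ^+ 2 + y - 4) * t * (t + 1) / 4 + (t + 1) * y * (y ^+ 2 + y - 4) / 2
  (* Corrects the term [i = 0], where [far_below 0] is 0 but the closed form for positive arguments
     would give -1. *)
  + y :> rat.
Proof.
have fb k : (0 < k)%N -> (far_below k)%:R = (k%:R * (k%:R + 1) - 2) / 2 :> rat.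
  move=> k0; have : (far_below k * 2 + 2 = k * k.+1)%N.
    by rewrite -far_below_closed k0.
  by move/(congr1 (fun n => n%:R : rat)); rewrite natrD !natrM (mulrSr 1 k); lra.
elim: m => [|m IH] mN /=.
  by rewrite big_ord1 subn0 [far_below 0]big_ord1 add0n natrM fb //; field.
have mN' : (m < N)%N by lia.
rewrite big_ord_recr natrD {}IH //= natrM natrD !fb ?subn_gt0 // natrB; last by lia.
by rewrite -[m.+1]addn1 natrD; field.
Qed.

Lemma path_far_extremal (N : nat) : (path_far N)%:R = extremal_bound N.+1 :> rat.
Proof.
have [m [NE|NE]] : exists m, N = (m + m).+1 \/ N = (m + m)%N by exists N./2; lia.
  rewrite (@path_far_split m.+1 0); last by lia.
  rewrite big_ord0 addn0 natrM half_path_sum; last by lia.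
  rewrite /extremal_bound (_ : odd N.+1 = false); last by lia.
  by rewrite NE !(mulrSr 1) !natrD; field.
rewrite (@path_far_split m 1) ?big_ord1; last by lia.
rewrite /extremal_bound (_ : odd N.+1 = true); last by lia.
(* A single vertex is treated apart: its halves are empty, while [half_path_sum] has at least one
   term. *)
case: m NE => [|m] NE; first by rewrite NE big_ord0 !mul0n !add0n.
rewrite natrD natrM half_path_sum; last by lia.
rewrite addn0 (_ : N - m.+1 = m.+1)%N ?maxnn; last by lia.
have : (far_below m.+1 * 2 + 2 = m.+1 * m.+2)%N by rewrite -far_below_closed.
have -> : (m.+1 * (far_below m.+1 + far_below m.+1) = m.+1 * (far_below m.+1 * 2))%N by lia.
move=> /(canRL (addnK 2)) ->.
have -> : (m.+1 * m.+2 - 2 = m * (m + 3))%N by nia.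
by rewrite NE natrM !(mulrSr 1) !(natrD, natrM) !(mulrSr 1); field.
Qed.

(** The increment has leading coefficient 25/24 against 1 on the left. Writing [k] as 2m+4 or 2m+3
    settles the parities and leaves polynomials in m >= 0. *)
Lemma extremal_bound_step (k : nat) : (2 < k)%N ->
  ((k - 2) * (k * (k - 1)))%:R < extremal_bound k - extremal_bound k.-1 :> rat.
Proof.
move=> k2; have [m [kE|kE]] : exists m, k = (m + m + 4)%N \/ k = (m + m + 3)%N.
  by exists (k - 3)./2; lia.
- rewrite /extremal_bound kE (_ : odd (m + m + 4) = false); last by lia.
  rewrite (_ : (m + m + 4).-1 = m + m + 3)%N; last by lia.
  rewrite (_ : odd (m + m + 3) = true); last by lia.
  rewrite (_ : m + m + 4 - 2 = m + m + 2)%N; last by lia.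
  rewrite (_ : m + m + 4 - 1 = m + m + 3)%N; last by lia.
  rewrite !natrM !natrD; have := ler0n rat m; move: (m%:R) => x x0; nra.
- rewrite /extremal_bound kE (_ : odd (m + m + 3) = true); last by lia.
  rewrite (_ : (m + m + 3).-1 = m + m + 2)%N; last by lia.
  rewrite (_ : odd (m + m + 2) = false); last by lia.
  rewrite (_ : m + m + 3 - 2 = m + m + 1)%N; last by lia.
  rewrite (_ : m + m + 3 - 1 = m + m + 2)%N; last by lia.
  rewrite !natrM !natrD; have := ler0n rat m; move: (m%:R) => x x0; nra.
Qed.

(** * Strict inequality beyond a diametral path *)

Lemma far_sum_convex (V : finType) (e : rel V) (a b : V) (S : {set V}) :
  is_tree e -> (forall u v, (dist e u v <= dist e a b)%N) ->
  convex e S -> interval e a b \proper S ->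
  (far_sum e S)%:R < extremal_bound #|S| :> rat.
Proof.
move=> tree_e diam; move: {2}#|S| (erefl #|S|) => k.
elim: k S => [|k IH] S cS conv IS.
  by move/cards0_eq: cS IS => ->; rewrite properE sub0set andbF.
have [subIS _] := andP IS.
have [_ [v0 v0S v0I]] := properP IS.
have v0SI : v0 \in S :\: interval e a b by rewrite inE v0I.
case: (@arg_maxnP _ v0 [in S :\: interval e a b] (dist e a) v0SI) => w /= wSI wmax.
have [wS wI] : w \in S /\ w \notin interval e a b by move: wSI; rewrite /= inE => /andP[].
have cSw : #|S :\ w| = k by have := cardsD1 w S; rewrite wS cS; case.
have convw : convex e (S :\ w) by apply: convexD1 wSI wmax.
have ISw : interval e a b \subset S :\ w by rewrite subsetD1 subIS wI.
(* With [k.+1] vertices in [S], this bounds the diameter by [k.+1 - 2], the factor in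
   [extremal_bound_step]. *)
have Ik : ((dist e a b).+1 <= k)%N by rewrite -cSw -(card_interval tree_e); apply: subset_leq_card.
have L0 : (0 < dist e a b)%N.
  apply: leq_trans (diam a w); rewrite lt0n (dist_eq0 tree_e).
  by apply: contraNneq wI => <-; rewrite inE (distxx tree_e).
have k2 : (2 < k.+1)%N by lia.
have := extremal_bound_step k2; rewrite cS [k.+1.-1]/= => step.
(* Only a weak inequality, since the remaining set may be the interval itself; strictness comes from
   [step]. *)
have prev : (far_sum e (S :\ w))%:R <= extremal_bound k :> rat.
  have [SwI|neq] := eqVneq (interval e a b) (S :\ w).
    rewrite -cSw -SwI (far_sum_diametral tree_e diam) path_far_extremal.
    by rewrite (card_interval tree_e).
  by rewrite -cSw ltW // IH // properEneq neq ISw.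
have := far_sumD1 tree_e diam conv wS; rewrite cS -(ler_nat rat) natrD.
have : (dist e a b * (k.+1 * (k.+1 - 1)))%:R <= ((k.+1 - 2) * (k.+1 * (k.+1 - 1)))%:R :> rat.
  by rewrite ler_nat leq_mul2r; lia.
lra.
Qed.

(** The degree counts the vertices at distance 1, exactly the terms that [far] erases from the total
    distance. *)
Lemma xi_d_far (V : finType) (e : rel V) : is_tree e ->
  xi_d e = (far_sum e [set: V] + xi_c e)%N.
Proof.
move=> tree_e.
have -> : far_sum e [set: V] = (\sum_v \sum_u ecc e v * far (dist e v u))%N.
  by apply: eq_big => [v|v _]; [rewrite inE | apply: eq_bigl => u; rewrite inE].
rewrite -big_split; apply: eq_bigr => v _ /=.
rewrite -big_distrr -mulnDr; congr (_ * _)%N.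
rewrite /deg -sum1dep_card [X in (_ + X)%N]big_mkcond -big_split; apply: eq_bigr => u _ /=.
by rewrite -(dist_eq1 tree_e) /far; case: eqP => [->|_]; rewrite ?addn0.
Qed.

(** * Recognising the path *)

Lemma path_coord_lipschitz (V : finType) (e : rel V) (f : V -> nat) (x y : V) :
  is_tree e -> (forall u v, e u v -> f v <= (f u).+1)%N ->
  (f y <= f x + dist e x y)%N.
Proof.
move=> tree_e lip; move: {2}(dist e x y) (erefl (dist e x y)) => k.
elim: k x => [|k IH] x xy.
  by have /eqP := xy; rewrite (dist_eq0 tree_e) => /eqP ->; rewrite leq_addr.
have [z /eqP xz zy] := dist_step tree_e xy.
rewrite (dist_eq1 tree_e) in xz.
by have := IH z zy; have := lip _ _ xz; rewrite xy zy; lia.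
Qed.

(** A path numbering changes by at most one along each edge, so its two ends are at least [#|V| - 1]
    apart and the diametral interval fills [V]. Conversely, the distance from [a] numbers the
    vertices. *)
Lemma path_iso_diametral (V : finType) (e : rel V) (a b : V) : is_tree e ->
  (forall u v, (dist e u v <= dist e a b)%N) ->
  graph_iso e (path_graph #|V|) <-> interval e a b = [set: V].
Proof.
move=> tree_e diam; split.
  have V0 : (0 < #|V|)%N by case: tree_e => _ [].
  case=> f [g fg gf] fe; apply/eqP; rewrite eqEcard subsetT /= cardsT.
  rewrite (card_interval tree_e).
  have lastV : (#|V|.-1 < #|V|)%N by rewrite prednK.
  have lip u v : e u v -> (f v <= (f u).+1)%N.
    by rewrite -fe => /orP[] /eqP; lia.
  have := path_coord_lipschitz (g (Ordinal V0)) (g (Ordinal lastV)) tree_e lip.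
  have := diam (g (Ordinal V0)) (g (Ordinal lastV)); rewrite !gf /=; lia.
move=> IT; have cV : #|V| = (dist e a b).+1.
  by rewrite -(card_interval tree_e) IT cardsT.
have coordP v : (dist e a v < #|V|)%N by rewrite cV ltnS diam.
have inI v : v \in interval e a b by rewrite IT inE.
exists (fun v => Ordinal (coordP v)) => [|x y].
  apply: inj_card_bij; last by rewrite card_ord.
  move=> x y [xy]; apply/eqP; rewrite -(dist_eq0 tree_e).
  by rewrite (interval_dist tree_e (inI x) (inI y)) xy subnn.
rewrite -(dist_eq1 tree_e) (interval_dist tree_e (inI x) (inI y)) /path_graph /=; lia.
Qed.

Theorem theorem3p5 (V : finType) (e : rel V) (n : nat)
    (tree_e : is_tree e) (order_n : #|V| = n) :
  (xi_d e)%:R - (xi_c e)%:R <= extremal_bound n :> rat /\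
  ((xi_d e)%:R - (xi_c e)%:R = extremal_bound n :> rat <->
   graph_iso e (path_graph n)).
Proof.
subst n; have /card_gt0P[x0 _] : (0 < #|V|)%N by case: tree_e => _ [].
case: (@arg_maxnP _ (x0, x0) predT (fun p => dist e p.1 p.2) isT) => -[a b] _ /= maxab.
have diam u v : (dist e u v <= dist e a b)%N by apply: (maxab (u, v)).
rewrite (xi_d_far tree_e) natrD addrK (path_iso_diametral tree_e diam).
(* Either equality holds, or the inequality is strict and both sides of the equivalence fail. *)
have [IT|nIT] := eqVneq (interval e a b) [set: V].
  suff -> : (far_sum e [set: V])%:R = extremal_bound #|V| :> rat by [].
  rewrite -cardsT -IT (far_sum_diametral tree_e diam) path_far_extremal.
  by rewrite (card_interval tree_e).
have lt : (far_sum e [set: V])%:R < extremal_bound #|V| :> rat.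
  rewrite -cardsT; apply: far_sum_convex tree_e diam _ _.
    by move=> x y _ _; apply: subsetT.
  by rewrite properEneq nIT subsetT.
split; first exact: ltW.
by split=> [E|/eqP]; [rewrite E ltxx in lt | rewrite (negPf nIT)].
Qed.
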